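(* In the case $\tilde\gamma=\gamma$, both the $(\delta W)^2$-jet scheme and the $(\delta t)$-jet scheme, regarded as maps $N:\mathcal{S}\to\Gamma$ sending an SDE $(a,b_1,\dots,b_k)$ to the corresponding jet map $\gamma$, are invariantly defined; that is, for each of them $$f\,N(a,b_1,\dots,b_k)=N\big(f_*(a,b_1,\dots,b_k)\big)$$ for every diffeomorphism $f:M\to M'$.
   Context: Fix integers $n,k$. $\mathcal{S}$ is the set of SDEs driven by $k$-dimensional Brownian motion on (a chart of) a manifold $M$ with $n$ local coordinates: it consists of tuples $(a,b_1,\dots,b_k)$ of smooth maps $a,b_\alpha:\mathbb{R}^n\times\mathbb{R}\to\mathbb{R}^n$ (depending on $(x,t)$), representing the Itô SDE $dX_t=a(X_t,t)\,dt+\sum_{\alpha=1}^k b_\alpha(X_t,t)\,dW_t^\alpha$. $\Gamma$ is the set of fields of maps $\gamma(x,t,v)\in\mathbb{R}^n$ with $x\in\mathbb{R}^n$, $t$ a time, and $v=(v^0,v^1,\dots,v^k)\in\mathbb{R}\times\mathbb{R}^k$ standing for $(\delta t,\delta W)$. A numerical scheme is a function $N:\mathcal{S}\to\Gamma$. A diffeomorphism $f:M\to M'$, written in local coordinates, acts on $\mathcal{S}$ by Itô's lemma: $$(f_*a)^i=\sum_{j=1}^n\frac{\partial f^i}{\partial x^j}a^j+\frac12\sum_{j,l=1}^n\sum_{\alpha=1}^k\frac{\partial^2 f^i}{\partial x^j\partial x^l}\,b_\alpha^j\,b_\alpha^l,\qquad (f_*b_\alpha)^i=\sum_{j=1}^n\frac{\partial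 f^i}{\partial x^j}\,b_\alpha^j,$$ where the right sides are evaluated at $(x,t)$ and the left sides at $(f(x),t)$. (Equivalently, it acts by the usual pushforward of vector fields on the coefficients $\overline a,b_\alpha$ of the Stratonovich form.) It acts on $\Gamma$ by $(f\gamma)(x,t,v)=f\big(\gamma(f^{-1}(x),t,v)\big)$. The Stratonovich drift is $\overline a(x,t)=a(x,t)-\frac12\sum_{\alpha=1}^k\sum_{j=1}^n b_\alpha(x,t)^j\frac{\partial b_\alpha}{\partial x^j}(x,t)$. The jet maps are defined by $\gamma(x,t,v)=\Phi(x,t,v,1)$, where $\Phi$ solves $\frac{\partial\Phi}{\partial s}(x,t,v,s)=X(\Phi(x,t,v,s),t,v)$, $\Phi(x,t,v,0)=x$, with - $(\delta W)^2$-jet scheme: $X(x,t,v)=\sum_{\alpha=1}^k v^\alpha b_\alpha(x,t)+\frac1k\sum_{\alpha=1}^k(v^\alpha)^2\,\overline a(x,t)$; - $(\delta t)$-jet scheme: $X(x,t,v)=\sum_{\alpha=1}^k v^\alpha b_\alpha(x,t)+v^0\,\overline a(x,t)$. In general the jet scheme uses a numerical approximation $\tilde\gamma$ to $\gamma$; the case $\tilde\gamma=\gamma$ means that the flow is computed exactly. *)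

(* Defs.v *)
(* MathComp-Analysis *)
From mathcomp Require Import all_boot all_order all_algebra.
From mathcomp Require Import all_classical all_reals all_analysis.

Set Implicit Arguments.
Unset Strict Implicit.
Unset Printing Implicit Defensive.

Import Order.TTheory GRing.Theory Num.Theory numFieldNormedType.Exports.

Local Open Scope classical_set_scope.
Local Open Scope ring_scope.

Section Smoothness.
Context {R : realType} {V W : normedModType R}.

(* For V finite-dimensional and D open this is the usual class C^m(D): the
   function is continuous, and at positive orders it is differentiable with
   all its directional derivatives of class C^(m-1). *)
Fixpoint class_C (m : nat) (D : set V) (h : V -> W) : Prop :=
  (forall x, D x -> {for x, continuous h}) /\
  match m with
  | 0 => True
  | m'.+1 => (forall x, D x -> differentiable h x) /\
             (forall v : V, class_C m' D (fun x => 'D_v h x))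
  end.

Definition smooth (D : set V) (h : V -> W) : Prop := forall m, class_C m D h.

End Smoothness.

Definition partial {R : realType} {n : nat} {W : normedModType R}
    (j : 'I_n) (h : 'rV[R]_n -> W) (x : 'rV[R]_n) : W :=
  'D_(delta_mx ord0 j) h x.

(* M and M' are open subsets of R^n (the ranges of charts; R^n itself is
   [setT]); f and g are only meaningful on M and M' respectively. *)
Record diffeomorphism {R : realType} {n : nat} (M M' : set 'rV[R]_n)
    (f g : 'rV[R]_n -> 'rV[R]_n) : Prop := {
  diffeo_open_dom : open M;
  diffeo_open_cod : open M';
  diffeo_fun : forall x, M x -> M' (f x);
  diffeo_inv : forall y, M' y -> M (g y);
  diffeo_funK : forall x, M x -> g (f x) = x;
  diffeo_invK : forall y, M' y -> f (g y) = y;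
  diffeo_smooth : smooth M f;
  diffeo_smooth_inv : smooth M' g }.

(* dX_t = drift(X_t,t) dt + \sum_alpha vol_alpha(X_t,t) dW^alpha_t (Ito form) *)
Record sde (R : realType) (n k : nat) : Type := SDE {
  drift : 'rV[R]_n -> R -> 'rV[R]_n;
  vol : 'I_k -> 'rV[R]_n -> R -> 'rV[R]_n }.

Definition smooth_sde {R : realType} {n k : nat} (M : set 'rV[R]_n)
    (S : sde R n k) : Prop :=
  smooth (M `*` setT) (fun p : 'rV[R]_n * R => drift S p.1 p.2) /\
  forall alpha : 'I_k,
    smooth (M `*` setT) (fun p : 'rV[R]_n * R => vol S alpha p.1 p.2).

(* f_* S by Ito's lemma; g is the inverse of f, so that the right-hand sides
   are evaluated at (g y, t). *)
Definition ito_push {R : realType} {n k : nat}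
    (f g : 'rV[R]_n -> 'rV[R]_n) (S : sde R n k) : sde R n k :=
  SDE
    (fun y t => let x := g y in
       \row_(i < n)
         (\sum_(j < n) partial j (fun z => f z ord0 i) x * drift S x t ord0 j
          + 2^-1 * \sum_(j < n) \sum_(l < n) \sum_(alpha < k)
              partial j (partial l (fun z => f z ord0 i)) x
              * vol S alpha x t ord0 j * vol S alpha x t ord0 l))
    (fun alpha y t => let x := g y in
       \row_(i < n)
         \sum_(j < n) partial j (fun z => f z ord0 i) x
                      * vol S alpha x t ord0 j).

Definition strat_drift {R : realType} {n k : nat} (S : sde R n k)
    (x : 'rV[R]_n) (t : R) : 'rV[R]_n :=
  drift S x t - 2^-1 *: \sum_(alpha < k) \sum_(j < n)
    vol S alpha x t ord0 j *: partial j (fun z => vol S alpha z t) x.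

(* Increments v = (v^0, (v^1, ..., v^k)) standing for (dt, dW). *)
Definition increment (R : realType) (k : nat) : Type := (R * 'rV[R]_k)%type.

(* Gamma. The values are optional because the exact flow may leave the domain,
   or explode, before unit flow time; no completeness of the coefficients is
   assumed. *)
Definition map_field (R : realType) (n k : nat) : Type :=
  'rV[R]_n -> R -> increment R k -> option 'rV[R]_n.

Definition map_field_push {R : realType} {n k : nat}
    (f g : 'rV[R]_n -> 'rV[R]_n) (gamma : map_field R n k) : map_field R n k :=
  fun y t v => omap f (gamma (g y) t v).

(* The two-sided derivatives at s = 0 and s = 1 are no restriction: a solution
   on [0, 1] extends to R differentiably (e.g. affinely), and only the values
   on [0, 1] are required to lie in M and to solve the equation. *)
Definition integral_curve {R : realType} {n : nat} (M : set 'rV[R]_n)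
    (X : 'rV[R]_n -> 'rV[R]_n) (x : 'rV[R]_n) (Phi : R -> 'rV[R]_n) : Prop :=
  Phi 0 = x /\
  forall s : R, 0 <= s <= 1 -> M (Phi s) /\ is_derive s 1 Phi (X (Phi s)).

(* [Some (Phi 1)] if an integral curve Phi exists on [0, 1], [None] otherwise.
   For X smooth on the open set M the choice made by [xget] is irrelevant, by
   uniqueness of integral curves. *)
Definition time1_flow {R : realType} {n : nat} (M : set 'rV[R]_n)
    (X : 'rV[R]_n -> 'rV[R]_n) (x : 'rV[R]_n) : option 'rV[R]_n :=
  xget None [set Some (Phi 1) | Phi in integral_curve M X x].

(* A scheme is parameterised by the domain M on which the SDE lives. *)
Definition scheme (R : realType) (n k : nat) : Type :=
  set 'rV[R]_n -> sde R n k -> map_field R n k.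

Definition dW2_jet_scheme {R : realType} {n k : nat} : scheme R n k :=
  fun M S x t v =>
    time1_flow M
      (fun z => \sum_(alpha < k) v.2 ord0 alpha *: vol S alpha z t
        + (k%:R^-1 * \sum_(alpha < k) v.2 ord0 alpha ^+ 2) *: strat_drift S z t)
      x.

Definition dt_jet_scheme {R : realType} {n k : nat} : scheme R n k :=
  fun M S x t v =>
    time1_flow M
      (fun z => \sum_(alpha < k) v.2 ord0 alpha *: vol S alpha z t
        + v.1 *: strat_drift S z t)
      x.

Definition invariantly_defined {R : realType} {n k : nat}
    (N : scheme R n k) : Prop :=
  forall (M M' : set 'rV[R]_n) (f g : 'rV[R]_n -> 'rV[R]_n) (S : sde R n k),
    diffeomorphism M M' f g -> smooth_sde M S ->
    forall (y : 'rV[R]_n) (t : R) (v : increment R k), M' y ->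
      map_field_push f g (N M S) y t v = N M' (ito_push f g S) y t v.

(* Main.v *)
Require Import Defs.
From mathcomp Require Import all_boot all_order all_algebra.
From mathcomp Require Import all_classical all_reals all_analysis.
From mathcomp Require Import ring lra.

Set Implicit Arguments.
Unset Strict Implicit.
Unset Printing Implicit Defensive.

Import Order.TTheory GRing.Theory Num.Theory numFieldNormedType.Exports.

Local Open Scope classical_set_scope.
Local Open Scope ring_scope.

(** For a fixed time and increment, both schemes take the time-1 flow of one
    vector field X = \sum_alpha w_alpha b_alpha + c abar, where the numbers
    w_alpha and c depend only on the increment.  So it suffices that f carries
    the field of an SDE to the field of its Ito push-forward, and that the
    time-1 flow is natural under diffeomorphisms.

    The first point is that f_* acts on the diffusion coefficients and on the
    Stratonovich drift as the ordinary push-forward of vector fields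
    ([ito_push_vol], [strat_drift_push]).  For the diffusion coefficients this
    is the definition.  For the drift, let P be the push-forward of b.
    Differentiating P along itself at y = f x, the chain and product rules
    give
      D_P P (y) = Df (D_b b) (x) + D^2 f (b, b) (x)
    ([covariant_derivative_push]); half of the last term, summed over the
    driving noises, is exactly the second-order term of Ito's lemma, and the
    two cancel in the Stratonovich drift.

    The second point ([time1_flow_push]) is that f o Phi is an integral curve
    of the pushed field when Phi is one of X, and conversely through the
    inverse g; in particular one flow exists up to time 1 exactly when the
    other does.  As the time-1 flow is the endpoint of a chosen integral
    curve, the two choices can be compared only because integral curves are
    unique.  The fields at hand are locally Lipschitz, being built by sums
    and products from maps of class C^1 ([class_C1_lipschitz],
    [strat_drift_lipschitz]), and uniqueness follows from the mean value
    inequality ([integral_curve_unique]). *)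

(** * Mean value inequality and local Lipschitz continuity *)

Lemma le_mx_normP (R : realFieldType) m n (A : 'M[R]_(m, n)) (c : R) :
  0 <= c -> (forall i j, `|A i j| <= c) -> `|A| <= c.
Proof.
move=> c0 Ac; rewrite [leLHS]/Num.Def.normr/= mx_normrE.
by apply: bigmax_le => // -[i j] _; exact: Ac.
Qed.

Lemma ler_coord_norm (R : realFieldType) m n (A : 'M[R]_(m, n)) i j :
  `|A i j| <= `|A|.
Proof.
rewrite [leRHS]/Num.Def.normr/= mx_normrE.
exact: (le_bigmax _ (fun ij : 'I_m * 'I_n => `|A ij.1 ij.2|) (i, j)).
Qed.

Lemma derive_coord (R : realFieldType) (V : normedModType R) m n
    (F : V -> 'M[R]_(m, n)) (x v : V) i j : derivable F x v ->
  'D_v (fun z => F z i j) x = ('D_v F x) i j.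
Proof. by move=> dF; rewrite derive_mx// mxE. Qed.

Lemma is_derive_coord (R : realFieldType) (V : normedModType R) m n
    (F : V -> 'M[R]_(m, n)) (x v : V) (dF : 'M[R]_(m, n)) i j :
  is_derive x v F dF -> is_derive x v (fun z => F z i j) (dF i j).
Proof.
case=> Fx <-; apply: DeriveDef; first by move/derivable_mxP: Fx; exact.
exact: derive_coord.
Qed.

(** The mean value theorem fails for vector-valued maps, but the inequality
    holds coordinatewise and hence in the max norm. *)
Lemma mean_value_inequality (R : realType) m n (Phi dPhi : R -> 'M[R]_(m, n))
    (a b c : R) : a <= b ->
  (forall s, a <= s <= b -> is_derive s 1 Phi (dPhi s)) ->
  (forall s, a <= s <= b -> `|dPhi s| <= c) ->
  `|Phi b - Phi a| <= c * (b - a).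
Proof.
move=> ab dP dPc.
have c0 : 0 <= c by apply: le_trans (dPc a _); rewrite ?lexx.
apply: le_mx_normP => [|i j]; first by rewrite mulr_ge0// subr_ge0.
have [||s sab] := @MVT_segment R (fun s => Phi s i j) (fun s => dPhi s i j)
    a b ab.
- move=> s; rewrite in_itv/= => /andP[/ltW as_ /ltW sb].
  by apply: is_derive_coord; apply: dP; rewrite as_.
- apply: derivable_within_continuous => s; rewrite in_itv/= => /dP h.
  exact: (@ex_derive _ _ _ _ _ _ _ (is_derive_coord i j h)).
rewrite !mxE => ->; rewrite normrM (ger0_norm (_ : 0 <= b - a)) ?subr_ge0//.
rewrite ler_wpM2r ?subr_ge0//; apply: le_trans (ler_coord_norm _ _ _) _.
by apply: dPc; rewrite in_itv/= in sab.
Qed.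

Lemma is_derive_line (R : realType) (V : normedModType R) (p u : V) (s : R) :
  is_derive s 1 (fun r : R => p + r *: u) u.
Proof.
have h : is_diff s (cst p + ( *:%R ^~ u)) (0 + *:%R ^~ u) by exact: is_diffD.
apply: DeriveDef; first by apply: diff_derivable; exact: ex_diff.
by rewrite deriveE ?diff_val/= ?add0r ?scale1r.
Qed.

Lemma is_derive_comp_diff (R : realType) (V W : normedModType R)
    (f : V -> W) (Phi : R -> V) (s : R) (v : V) :
  differentiable f (Phi s) -> is_derive s 1 Phi v ->
  is_derive s 1 (f \o Phi) ('d f (Phi s) v).
Proof.
move=> df [/derivable1_diffP dPhi dv].
have dc := differentiable_comp dPhi df.
apply: DeriveDef; first exact/derivable1_diffP.
by rewrite deriveE// diff_comp//= -(deriveE _ dPhi) dv.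
Qed.

Lemma derive_sum_basis (R : realType) n (W : normedModType R)
    (h : 'rV[R]_n -> W) (x u : 'rV[R]_n) : differentiable h x ->
  'D_u h x = \sum_(j < n) u ord0 j *: partial j h x.
Proof.
move=> dh; rewrite deriveE// [u in LHS]row_sum_delta linear_sum.
by apply: eq_bigr => j _; rewrite linearZ /partial deriveE.
Qed.

Lemma continuous_near_norm_le (R : realType) (V W : normedModType R)
    (h : V -> W) (x : V) :
  {for x, continuous h} -> \forall z \near x, `|h z| <= `|h x| + 1.
Proof. by move=> hx; apply: (cvgr_norm_le _ hx); rewrite ltrDl. Qed.

(** The partial derivatives are bounded on a small ball around x, which is
    convex, so the mean value inequality applies to h along its segments. *)
Lemma class_C1_lipschitz (R : realType) n m (M : set 'rV[R]_n)
    (h : 'rV[R]_n -> 'rV[R]_m) (x : 'rV[R]_n) :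
  open M -> class_C 1 M h -> M x -> lipschitz_on h (nbhs (x, x)).
Proof.
move=> oM [_ [dh Dh]] Mx.
pose C := \sum_(j < n) (`|partial j h x| + 1).
have nC : \forall z \near x,
    M z /\ forall j, `|partial j h z| <= `|partial j h x| + 1.
  apply: filterI; first exact: open_nbhs_nbhs.
  apply: (@filter_forall _ _ _ (nbhs x)) => j.
  have /(_ x Mx) cj := (Dh (delta_mx ord0 j)).1.
  exact: (continuous_near_norm_le cj).
have /nbhs_ballP[e /= e0 He] := nC.
apply/ex_dom_bound; exists C.
exists (ball x e, ball x e); first by split; exact: nbhsx_ballx.
move=> [p q] [/= xp xq].
pose c s := q + s *: (p - q).
have Hc s : 0 <= s <= 1 -> ball x e (c s).
  move=> /andP[s0 s1]; rewrite -ball_normE/= in xp xq *.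
  have -> : x - c s = s *: (x - p) + (1 - s) *: (x - q).
    by apply/rowP => i; rewrite !mxE; ring.
  apply: le_lt_trans (ler_normD _ _) _.
  rewrite !normrZ (ger0_norm s0) (ger0_norm (_ : 0 <= 1 - s)) ?subr_ge0//.
  have [->|sN1] := eqVneq s 1; first by rewrite subrr mul0r addr0 mul1r.
  have s1' : s < 1 by rewrite lt_neqAle sN1.
  by nra.
have := @mean_value_inequality R 1 m (h \o c) (fun s => 'D_(p - q) h (c s)) 0 1
  (C * `|p - q|) ler01.
rewrite /= /c scale1r scale0r addr0 subrKC subr0 mulr1; apply.
- move=> s s01; have [Mcs _] := He _ (Hc _ s01).
  rewrite deriveE; last exact: dh.
  apply: is_derive_comp_diff; first exact: dh.
  exact: is_derive_line.
- move=> s s01; have [Mcs Bcs] := He _ (Hc _ s01).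
  rewrite derive_sum_basis; last exact: dh.
  apply: le_trans (ler_norm_sum _ _ _) _.
  rewrite mulr_suml; apply: ler_sum => j _.
  by rewrite normrZ mulrC ler_pM// ler_coord_norm.
Qed.

Lemma lipschitz_onP (R : realType) (V W : normedModType R) (h : V -> W)
    (F : set_system (V * V)) (FF : ProperFilter F) :
  lipschitz_on h F <->
  exists k, \forall p \near F, `|h p.1 - h p.2| <= k * `|p.1 - p.2|.
Proof. by rewrite /lipschitz_on; split=> /ex_dom_bound. Qed.

Lemma lipschitz_onD (R : realType) (V W : normedModType R) (h h' : V -> W)
    (F : set_system (V * V)) (FF : ProperFilter F) :
  lipschitz_on h F -> lipschitz_on h' F -> lipschitz_on (fun x => h x + h' x) F.
Proof.
move=> /lipschitz_onP[k hk] /lipschitz_onP[k' hk']; apply/lipschitz_onP.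
exists (k + k'); near=> p.
rewrite opprD addrACA (le_trans (ler_normD _ _))// mulrDl lerD//.
- by near: p.
- by near: p.
Unshelve. all: by end_near. Qed.

Lemma lipschitz_onZ (R : realType) (V W : normedModType R) (c : R) (h : V -> W)
    (F : set_system (V * V)) (FF : ProperFilter F) :
  lipschitz_on h F -> lipschitz_on (fun x => c *: h x) F.
Proof.
move=> /lipschitz_onP[k hk]; apply/lipschitz_onP; exists (`|c| * k); near=> p.
rewrite -scalerBr normrZ -mulrA ler_wpM2l//.
by near: p.
Unshelve. all: by end_near. Qed.

Lemma lipschitz_on_cst (R : realType) (V W : normedModType R) (a : W)
    (F : set_system (V * V)) (FF : ProperFilter F) :
  lipschitz_on (fun _ : V => a) F.
Proof.
apply/lipschitz_onP; exists 0; near=> p.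
by rewrite subrr normr0 mul0r.
Unshelve. all: by end_near. Qed.

Lemma lipschitz_on_sum (R : realType) (V W : normedModType R) (I : finType)
    (h : I -> V -> W) (F : set_system (V * V)) (FF : ProperFilter F) :
  (forall i, lipschitz_on (h i) F) -> lipschitz_on (fun x => \sum_i h i x) F.
Proof.
move=> hF; elim: (index_enum I) => [|i r IH].
  rewrite [X in lipschitz_on X](_ : _ = fun=> 0); first exact: lipschitz_on_cst.
  by apply/funext => x; rewrite big_nil.
rewrite [X in lipschitz_on X](_ : _ = fun x => h i x + \sum_(j <- r) h j x).
  exact: lipschitz_onD.
by apply/funext => x; rewrite big_cons.
Qed.

Lemma lipschitz_on_coord (R : realType) (V : normedModType R) m n
    (h : V -> 'M[R]_(m, n)) i j (F : set_system (V * V)) (FF : ProperFilter F) :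
  lipschitz_on h F -> lipschitz_on (fun x => h x i j) F.
Proof.
move=> /lipschitz_onP[k hk]; apply/lipschitz_onP; exists k; near=> p.
rewrite (le_trans _ (_ : `|h p.1 - h p.2| <= _))//.
  by have := ler_coord_norm (h p.1 - h p.2) i j; rewrite !mxE.
by near: p.
Unshelve. all: by end_near. Qed.

(** For products, continuity supplies local bounds on both factors. *)
Lemma lipschitz_on_scale (R : realType) (V W : normedModType R)
    (c : V -> R) (h : V -> W) (x : V) :
  {for x, continuous c} -> {for x, continuous h} ->
  lipschitz_on c (nbhs (x, x)) -> lipschitz_on h (nbhs (x, x)) ->
  lipschitz_on (fun z => c z *: h z) (nbhs (x, x)).
Proof.
move=> cc ch /lipschitz_onP[k ck] /lipschitz_onP[l hl]; apply/lipschitz_onP.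
exists (k * (`|h x| + 1) + (`|c x| + 1) * l).
have bc : \forall p \near (x, x), `|c p.2| <= `|c x| + 1.
  exact: (cvg_snd (continuous_near_norm_le cc)).
have bh : \forall p \near (x, x), `|h p.1| <= `|h x| + 1.
  exact: (cvg_fst (continuous_near_norm_le ch)).
near=> p.
have -> : c p.1 *: h p.1 - c p.2 *: h p.2 =
    (c p.1 - c p.2) *: h p.1 + c p.2 *: (h p.1 - h p.2).
  by rewrite scalerBl scalerBr addrA subrK.
rewrite (le_trans (ler_normD _ _))// !normrZ mulrDl lerD//.
- rewrite mulrAC ler_pM//; first by near: p.
  by near: p.
- rewrite -mulrA ler_pM//; first by near: p.
  by near: p.
Unshelve. all: by end_near. Qed.

(** * Uniqueness of integral curves *)

(** If two curves agree at S then, on a short interval [S, s], the maximum of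
    their distance u is at most half of itself by the mean value inequality,
    so they agree on it.  Hence the infimum of the times where they differ
    cannot be a point where they agree; by continuity it is one. *)
Lemma integral_curve_unique (R : realType) n (M : set 'rV[R]_n)
    (X : 'rV[R]_n -> 'rV[R]_n) (x : 'rV[R]_n) (Phi Psi : R -> 'rV[R]_n) :
  (forall p, M p -> lipschitz_on X (nbhs (p, p))) ->
  integral_curve M X x Phi -> integral_curve M X x Psi -> Phi 1 = Psi 1.
Proof.
move=> lipX [Phi0 dPhi] [Psi0 dPsi].
pose u s := Phi s - Psi s.
have is_derive_cont (F : R -> 'rV[R]_n) (s : R) v :
    is_derive s 1 F v -> {for s, continuous F}.
  by case=> /derivable1_diffP /differentiable_continuous.
have cPhi (s : R) : 0 <= s <= 1 -> {for s, continuous Phi}.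
  by move=> /dPhi[_ /is_derive_cont].
have cPsi (s : R) : 0 <= s <= 1 -> {for s, continuous Psi}.
  by move=> /dPsi[_ /is_derive_cont].
have du (s : R) : 0 <= s <= 1 -> is_derive s 1 u (X (Phi s) - X (Psi s)).
  by move=> s01; apply: is_deriveB; [case: (dPhi s s01)|case: (dPsi s s01)].
have uc (s : R) : 0 <= s <= 1 -> {for s, continuous u}.
  by move=> /du /is_derive_cont.
have local (S : R) : 0 <= S <= 1 -> u S = 0 ->
    exists2 d, 0 < d & forall s, S <= s < S + d -> s <= 1 -> u s = 0.
  move=> S01 uS; have S0 : 0 <= S by case/andP: S01.
  have PS : Phi S = Psi S by apply/eqP; rewrite -subr_eq0; apply/eqP.
  have /lipschitz_onP[L XL] := lipX _ (dPhi S S01).1.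
  have : \forall s \near S, `|X (Phi s) - X (Psi s)| <= L * `|u s|.
    rewrite {2}PS in XL.
    exact: (cvg_pair (cPhi S S01) (cPsi S S01) XL).
  move=> /nbhs_ballP[e /= e0 He].
  have L1 : 0 < `|L| + 1 by rewrite ltr_wpDl.
  (* This length makes the Lipschitz constant times s - S at most 1/2; |L| + 1
     replaces L to be positive. *)
  exists (Num.min e (2 * (`|L| + 1))^-1).
    by rewrite lt_min e0 invr_gt0 mulr_gt0.
  move=> s /andP[Ss]; rewrite -ltrBlDl lt_min => /andP[se sL] s1.
  have [] := @EVT_max R (fun r => `|u r|) S s Ss.
    apply: continuous_in_subspaceT => r; rewrite inE/= in_itv/= => /andP[Sr rs].
    apply: continuous_comp; last exact: norm_continuous.
    by apply: uc; rewrite (le_trans S0 Sr) (le_trans rs s1).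
  move=> c; rewrite in_itv/= => /andP[Sc cs] Hc.
  have in01 (r : R) : S <= r <= c -> 0 <= r <= 1.
    move=> /andP[Sr rc].
    by rewrite (le_trans S0 Sr) (le_trans rc)// (le_trans cs).
  have := @mean_value_inequality R 1 n u (fun r => X (Phi r) - X (Psi r)) S c
    ((`|L| + 1) * `|u c|) Sc (fun r h => du r (in01 r h)).
  rewrite uS subr0 => h.
  have {}h : `|u c| <= (`|L| + 1) * `|u c| * (c - S).
    apply: h => r /andP[Sr rc].
    have := He r; rewrite -ball_normE/= distrC ger0_norm ?subr_ge0// => /(_ _).
    move=> /(_ _)/le_trans; apply.
      by rewrite (le_lt_trans _ se)// lerD2r (le_trans rc).
    apply: (@le_trans _ _ ((`|L| + 1) * `|u r|)).
      by rewrite ler_wpM2r// (le_trans (ler_norm L))// lerDl.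
    by rewrite ler_wpM2l ?(ltW L1)// Hc// in_itv/= Sr (le_trans rc).
  have K2 : (`|L| + 1) * (c - S) <= 2^-1.
    rewrite -ler_pdivlMl// -invfM mulrC ltW// (le_lt_trans _ sL)//.
    by rewrite lerD2r.
  have uc0 : `|u c| <= 0.
    move: h; rewrite mulrAC => /le_trans /(_ (ler_wpM2r (normr_ge0 _) K2)).
    by lra.
  apply/eqP; rewrite -normr_le0 (le_trans _ uc0)// Hc//.
  by rewrite in_itv/= Ss lexx.
pose Z : set R := [set s | 0 <= s <= 1 /\ u s != 0].
apply/eqP; rewrite -subr_eq0; apply/eqP; apply: contrapT => /eqP u1.
have Z1 : Z 1 by split=> //; rewrite ler01 lexx.
have Zinf : has_inf Z by split; [exists 1|exists 0 => s [/andP[]]].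
set S := inf Z.
have S01 : 0 <= S <= 1.
  apply/andP; split; first by apply: lb_le_inf; [exists 1|move=> s [/andP[]]].
  by apply: ge_inf => //; case: Zinf.
have uS : u S = 0.
  apply/eqP/negPn/negP => uS0.
  have S0 : 0 < S.
    rewrite lt_neqAle (andP S01).1 andbT; apply: contra uS0 => /eqP <-.
    by rewrite /u Phi0 Psi0 subrr.
  have /nbhs_ballP[e /= e0 He] : \forall s \near S, u s != 0.
    by apply: (cvgr_neq0 _ (uc S S01)).
  (* S - m / 2 is a time before S, still in [0, 1], where the curves differ. *)
  pose m := Num.min e S.
  have m0 : 0 < m by rewrite lt_min e0.
  have [me mS] : m <= e /\ m <= S by rewrite !ge_min !lexx orbT.
  have s0 : 0 <= S - m / 2 by lra.
  have Zs : Z (S - m / 2).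
    split; first by have /andP[_ S1] := S01; apply/andP; split; lra.
    apply: He; rewrite -ball_normE/= subKr ger0_norm; lra.
  by have : S <= S - m / 2 by [apply: ge_inf => //; case: Zinf]; lra.
have [d d0 Hd] := local S S01 uS.
have [z [/andP[z0 z1] uz] zS] := inf_adherent d0 Zinf.
move: (uz); rewrite Hd ?eqxx//.
by rewrite zS andbT; apply: ge_inf; [case: Zinf|split=> //; rewrite z0].
Qed.

(** * Coordinates and slices *)

Lemma differentiable_coord_comp (R : realType) (V : normedModType R) m n
    (F : V -> 'M[R]_(m, n)) (x : V) i j :
  differentiable F x -> differentiable (fun z => F z i j) x.
Proof.
move=> dF; apply: (@differentiable_comp _ _ _ _ F
  (fun A : 'M[R]_(m, n) => A i j)) => //.
exact: differentiable_coord.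
Qed.

Lemma diff_coordE (R : realType) n m (f : 'rV[R]_n -> 'rV[R]_m)
    (x v : 'rV[R]_n) (i : 'I_m) : differentiable f x ->
  ('d f x v) ord0 i =
  \sum_(j < n) partial j (fun z => f z ord0 i) x * v ord0 j.
Proof.
move=> df; rewrite -deriveE// -derive_coord; last exact: diff_derivable.
rewrite derive_sum_basis; last exact: differentiable_coord_comp.
by apply: eq_bigr => j _; rewrite mulrC.
Qed.

(** Freezing the time variable: derivatives of the slice in direction v are
    slices of derivatives in direction (v, 0). *)
Lemma class_C_slice (R : realType) (V T W : normedModType R) (k : nat)
    (M : set V) (F : V * T -> W) (t : T) :
  class_C k (M `*` setT) F -> class_C k M (fun x => F (x, t)).
Proof.
have dpair (x : V) : differentiable (fun z : V => (z, t)) x.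
  by apply: differentiable_pair => //; exact: differentiable_cst.
have cslice (G : V * T -> W) :
    (forall p, (M `*` setT) p -> {for p, continuous G}) ->
    forall x, M x -> {for x, continuous (fun z => G (z, t))}.
  move=> cG x Mx; apply: (@continuous_comp _ _ _ (fun z : V => (z, t)) G).
    exact: differentiable_continuous.
  exact: (cG (x, t) (conj Mx I)).
elim: k F => [|k IH] F [/cslice cF]; first by [].
move=> [dF DF]; split=> //.
split=> [x Mx|v].
  apply: (@differentiable_comp _ _ _ _ (fun z : V => (z, t)) F) => //.
  exact: (dF (x, t) (conj Mx I)).
rewrite [X in class_C k M X](_ : _ = fun x => 'D_(v, 0) F (x, t)).
  exact: (IH _ (DF (v, 0))).
apply/funext => x; rewrite /derive.
apply: (congr1 (fun q : R -> W => lim (q @ 0^'))).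
apply/funext => h /=; congr (_ *: (F _ - _)).
by rewrite [RHS]surjective_pairing /= scaler0 add0r.
Qed.

(** * Diffeomorphisms and naturality of the flow *)

Lemma diff_local_inverse (R : realType) (V W : normedModType R)
    (f : V -> W) (g : W -> V) (x v : V) :
  differentiable f x -> differentiable g (f x) ->
  (\forall z \near x, g (f z) = z) -> 'd g (f x) ('d f x v) = v.
Proof.
move=> df dg gf; have := diff_comp df dg => /(congr1 (@^~ v)) /= <-.
rewrite -deriveE; last exact: differentiable_comp.
by rewrite (@near_eq_derive _ _ _ _ id) ?derive_id.
Qed.

Lemma diffeomorphism_sym (R : realType) n (M M' : set 'rV[R]_n)
    (f g : 'rV[R]_n -> 'rV[R]_n) :
  diffeomorphism M M' f g -> diffeomorphism M' M g f.
Proof. by case. Qed.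

Lemma diffeo_differentiable (R : realType) n (M M' : set 'rV[R]_n)
    (f g : 'rV[R]_n -> 'rV[R]_n) x :
  diffeomorphism M M' f g -> M x -> differentiable f x.
Proof. by move=> fg Mx; have [_ [+ _]] := diffeo_smooth fg 1; exact. Qed.

Lemma diffeo_diffK (R : realType) n (M M' : set 'rV[R]_n)
    (f g : 'rV[R]_n -> 'rV[R]_n) x v :
  diffeomorphism M M' f g -> M x -> 'd g (f x) ('d f x v) = v.
Proof.
move=> fg Mx; apply: diff_local_inverse.
- exact: (diffeo_differentiable fg).
- have [_ [+ _]] := diffeo_smooth_inv fg 1; apply.
  exact: (diffeo_fun fg).
have : nbhs x M.
  by apply: open_nbhs_nbhs; split => //; exact: (diffeo_open_dom fg).
by apply: filterS => z Mz /=; rewrite (diffeo_funK fg).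
Qed.

Lemma integral_curve_push (R : realType) n (M M' : set 'rV[R]_n)
    (f g X Y : 'rV[R]_n -> 'rV[R]_n) x Phi :
  diffeomorphism M M' f g ->
  (forall z, M z -> Y (f z) = 'd f z (X z)) ->
  integral_curve M X x Phi -> integral_curve M' Y (f x) (f \o Phi).
Proof.
move=> fg XY [Phi0 dPhi]; split; first by rewrite /= Phi0.
move=> s s01; have [MPhi dPhis] := dPhi s s01.
split; first exact: (diffeo_fun fg).
rewrite /= XY//; apply: is_derive_comp_diff => //.
exact: (diffeo_differentiable fg).
Qed.

Lemma time1_flow_some (R : realType) n (M : set 'rV[R]_n)
    (X : 'rV[R]_n -> 'rV[R]_n) x Phi :
  (forall p, M p -> lipschitz_on X (nbhs (p, p))) ->
  integral_curve M X x Phi -> time1_flow M X x = Some (Phi 1).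
Proof.
move=> lipX HPhi; rewrite /time1_flow; apply: xget_unique; first by exists Phi.
by move=> _ [Psi HPsi <-]; rewrite (integral_curve_unique lipX HPsi HPhi).
Qed.

(** Uniqueness for X alone suffices: g carries the integral curves of Y back to
    those of X. *)
Lemma time1_flow_push (R : realType) n (M M' : set 'rV[R]_n)
    (f g X Y : 'rV[R]_n -> 'rV[R]_n) :
  diffeomorphism M M' f g ->
  (forall p, M p -> lipschitz_on X (nbhs (p, p))) ->
  (forall y, M' y -> Y y = 'd f (g y) (X (g y))) ->
  forall y, M' y -> omap f (time1_flow M X (g y)) = time1_flow M' Y y.
Proof.
move=> fg lipX YX y M'y; have gf := diffeomorphism_sym fg.
have XY z : M' z -> X (g z) = 'd g z (Y z).
  move=> M'z; have Mgz := diffeo_inv fg M'z.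
  by rewrite YX// -[z in 'd g z _](diffeo_invK fg M'z) (diffeo_diffK _ fg).
have [[Phi HPhi]|noPhi] := pselect (exists Phi, integral_curve M X (g y) Phi).
  rewrite (time1_flow_some lipX HPhi)/=.
  rewrite /time1_flow; apply/esym/xget_unique.
    exists (f \o Phi) => //.
    rewrite -[y](diffeo_invK fg M'y).
    apply: (integral_curve_push fg) HPhi => z Mz.
    by rewrite YX ?(diffeo_funK fg)//; exact: (diffeo_fun fg).
  move=> _ [Psi HPsi <-]; congr Some.
  have := integral_curve_unique lipX HPhi (integral_curve_push gf XY HPsi).
  move=> -> /=; rewrite (diffeo_invK fg)//.
  by have [] := HPsi.2 1; rewrite ?ler01 ?lexx.
rewrite /time1_flow !xgetPN//.
- by move=> _ [Psi HPsi _]; apply: noPhi; exists (g \o Psi);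
     exact: (integral_curve_push gf XY HPsi).
- by move=> _ [Phi HPhi _]; apply: noPhi; exists Phi.
Qed.

(** * Transformation of the Stratonovich drift *)

Lemma derive_comp (R : realType) (U V W : normedModType R)
    (g : U -> V) (h : V -> W) (y v : U) :
  differentiable g y -> differentiable h (g y) ->
  'D_v (h \o g) y = 'D_('d g y v) h (g y).
Proof.
move=> dg dh; rewrite !deriveE//; last exact: differentiable_comp.
by rewrite diff_comp.
Qed.

(** D_P P = Df (D_b b) + D^2 f (b, b) for the push-forward P of b.  The partial
    derivatives of the coordinates of f agree with the coordinates of the smooth
    maps D_l f only on M, so P is compared near y with Q o g, where Q is built
    from the latter; Dg then turns P y = Df b back into b. *)
Lemma covariant_derivative_push (R : realType) n (M M' : set 'rV[R]_n)
    (f g b : 'rV[R]_n -> 'rV[R]_n) (y : 'rV[R]_n) (i : 'I_n) :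
  diffeomorphism M M' f g -> M' y -> differentiable b (g y) ->
  let x := g y in
  let P := fun z => \row_(i < n)
    \sum_(l < n) partial l (fun z => f z ord0 i) (g z) * b (g z) ord0 l in
  (\sum_(j < n) P y ord0 j *: partial j P y) ord0 i =
  \sum_(j < n) partial j (fun z => f z ord0 i) x *
      (\sum_(l < n) b x ord0 l *: partial l b x) ord0 j +
  \sum_(j < n) \sum_(l < n)
      partial j (partial l (fun z => f z ord0 i)) x * b x ord0 j * b x ord0 l.
Proof.
move=> fg M'y db x P; have Mx : M x by exact: (diffeo_inv fg).
have fx : f x = y by exact: (diffeo_invK fg).
have [_ [df Df]] := diffeo_smooth fg 2.
have oM := diffeo_open_dom fg; have oM' := diffeo_open_cod fg.
have nMx : \forall z \near x, M z by apply: open_nbhs_nbhs.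
have nM'y : \forall z \near y, M' z by apply: open_nbhs_nbhs.
have dg : differentiable g y.
  exact: (diffeo_differentiable (diffeomorphism_sym fg)).
pose F (k l : 'I_n) z := ('D_(delta_mx ord0 l) f z) ord0 k.
have FE k l z : M z -> partial l (fun z => f z ord0 k) z = F k l z.
  move=> Mz; rewrite /partial derive_coord//.
  by apply: diff_derivable; exact: df.
have dF k l : differentiable (F k l) x.
  apply: differentiable_coord_comp.
  by have [_ [+ _]] := Df (delta_mx ord0 l); exact.
have dbl l : differentiable (fun z => b z ord0 l) x.
  exact: differentiable_coord_comp.
pose Q (k : 'I_n) : 'rV[R]_n -> R :=
  \sum_(l < n) (F k l * (fun z => b z ord0 l)).
have dQ k : differentiable (Q k) x.
  by apply: differentiable_sum => l; exact: differentiableM.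
have QE k z : M z ->
    \sum_(l < n) partial l (fun z => f z ord0 k) z * b z ord0 l = Q k z.
  move=> Mz; rewrite /Q fct_sumE; apply: eq_bigr => l _.
  by rewrite FE.
have PQ k : \forall z \near y, P z ord0 k = (Q k \o g) z.
  by apply: filterS nM'y => z M'z; rewrite mxE QE//; exact: (diffeo_inv fg).
have dQg k : differentiable (Q k \o g) y by exact: differentiable_comp.
have dP v : derivable P y v.
  apply/derivable_mxP => k0 k; rewrite ord1.
  apply: (@near_eq_derivable _ _ _ (Q k \o g)); last exact: diff_derivable.
  by apply: filterS (PQ k).
have Py : P y = 'd f x (b x).
  apply/rowP => k; rewrite diff_coordE ?mxE//; exact: df.
transitivity ('D_(b x) (Q i) x).
  rewrite summxE; under eq_bigr => j _.
    rewrite mxE /partial -derive_coord// (near_eq_derive _ (PQ i)).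
    over.
  transitivity ('D_(P y) (Q i \o g) y); first by rewrite derive_sum_basis.
  rewrite derive_comp//; congr ('D_ _ _ _).
  by rewrite Py -[in 'd g y]fx (diffeo_diffK _ fg).
rewrite derive_sum; last first.
  by move=> l; apply: diff_derivable; exact: differentiableM.
rewrite [X in _ = _ + X]exchange_big/= -big_split/=; apply: eq_bigr => l _.
rewrite deriveM; [|exact: diff_derivable..].
rewrite -derive_sum_basis// -FE// derive_coord; last exact: diff_derivable.
congr (_ + _); rewrite derive_sum_basis// scaler_sumr; apply: eq_bigr => j _.
rewrite /partial (@near_eq_derive _ _ _ _ (F i l)).
  by rewrite /GRing.scale/=; ring.
by apply: filterS nMx => z Mz; exact: FE.
Qed.

Lemma ito_push_vol (R : realType) n k (M M' : set 'rV[R]_n)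
    (f g : 'rV[R]_n -> 'rV[R]_n) (S : sde R n k) y t alpha :
  diffeomorphism M M' f g -> M' y ->
  vol (ito_push f g S) alpha y t = 'd f (g y) (vol S alpha (g y) t).
Proof.
move=> fg M'y; apply/rowP => i; rewrite mxE diff_coordE//.
exact: (diffeo_differentiable fg (diffeo_inv fg M'y)).
Qed.

Lemma smooth_sde_vol (R : realType) n k (M : set 'rV[R]_n) (S : sde R n k)
    m alpha t : smooth_sde M S -> class_C m M (fun z => vol S alpha z t).
Proof. by move=> [_ /(_ alpha m)/class_C_slice]; exact. Qed.

Lemma smooth_sde_drift (R : realType) n k (M : set 'rV[R]_n) (S : sde R n k)
    m t : smooth_sde M S -> class_C m M (fun z => drift S z t).
Proof. by move=> [/(_ m)/class_C_slice + _]; exact. Qed.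

Lemma strat_drift_coord (R : realType) n k (S : sde R n k) x t (i : 'I_n) :
  (strat_drift S x t) ord0 i = drift S x t ord0 i - 2^-1 *
    \sum_(alpha < k) (\sum_(j < n) vol S alpha x t ord0 j *:
      partial j (fun z => vol S alpha z t) x) ord0 i.
Proof. by rewrite /strat_drift mxE [X in _ + X]mxE [X in _ - X]mxE summxE. Qed.

(** The Hessian term of Ito's lemma cancels against the one in the self
    derivatives of the pushed diffusion coefficients. *)
Lemma strat_drift_push (R : realType) n k (M M' : set 'rV[R]_n)
    (f g : 'rV[R]_n -> 'rV[R]_n) (S : sde R n k) y t :
  diffeomorphism M M' f g -> smooth_sde M S -> M' y ->
  strat_drift (ito_push f g S) y t = 'd f (g y) (strat_drift S (g y) t).
Proof.
move=> fg smS M'y; have Mx : M (g y) := diffeo_inv fg M'y.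
apply/rowP => i; rewrite diff_coordE; last exact: (diffeo_differentiable fg Mx).
rewrite [LHS]strat_drift_coord.
have covE alpha := covariant_derivative_push i fg M'y
  ((smooth_sde_vol 1 alpha t smS).2.1 _ Mx).
have exch : \sum_(alpha < k) \sum_(j < n) \sum_(l < n)
    partial j (partial l (fun z => f z ord0 i)) (g y)
    * vol S alpha (g y) t ord0 j * vol S alpha (g y) t ord0 l =
  \sum_(j < n) \sum_(l < n) \sum_(alpha < k)
    partial j (partial l (fun z => f z ord0 i)) (g y)
    * vol S alpha (g y) t ord0 j * vol S alpha (g y) t ord0 l.
  by rewrite exchange_big/=; apply: eq_bigr => j _; rewrite exchange_big.
rewrite (eq_bigr _ (fun alpha _ => covE alpha)) big_split/= exch mxE.
under [RHS]eq_bigr => j _ do rewrite strat_drift_coord mulrBr mulrCA mulr_sumr.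
rewrite sumrB -mulr_sumr [X in _ = _ - _ * X]exchange_big/=.
by rewrite mulrDr opprD addrACA subrr addr0.
Qed.

(** * Invariance of the jet schemes *)

Lemma strat_drift_lipschitz (R : realType) n k (M : set 'rV[R]_n)
    (S : sde R n k) t x : open M -> smooth_sde M S -> M x ->
  lipschitz_on (fun z => strat_drift S z t) (nbhs (x, x)).
Proof.
move=> oM smS Mx; rewrite /strat_drift.
under eq_fun do rewrite -scaleNr.
apply: lipschitz_onD.
  by apply: (class_C1_lipschitz oM) Mx; exact: smooth_sde_drift.
apply: lipschitz_onZ; apply: lipschitz_on_sum => alpha.
apply: lipschitz_on_sum => j.
have [cb [_ Db]] := smooth_sde_vol 2 alpha t smS.
have cbx := cb x Mx.
apply: lipschitz_on_scale.
- apply: (@continuous_comp _ _ _ (fun z => vol S alpha z t)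
    (fun A : 'rV[R]_n => A ord0 j)) => //.
  exact: coord_continuous.
- exact: ((Db (delta_mx ord0 j)).1 x Mx).
- apply: lipschitz_on_coord.
  by apply: (class_C1_lipschitz oM) Mx; exact: smooth_sde_vol.
- exact: (class_C1_lipschitz oM (Db (delta_mx ord0 j)) Mx).
Qed.

Lemma diff_lincomb (R : realType) (V W : normedModType R) (f : V -> W) (x : V)
    k (w : 'I_k -> R) (b : 'I_k -> V) (c : R) (a : V) :
  'd f x (\sum_(alpha < k) w alpha *: b alpha + c *: a) =
  \sum_(alpha < k) w alpha *: 'd f x (b alpha) + c *: 'd f x a.
Proof.
rewrite linearD linearZ linear_sum; congr (_ + _).
by apply: eq_bigr => alpha _; rewrite linearZ.
Qed.

(** Common form of both schemes: w is the Brownian increment, and c is either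
    the mean of the squared increments or the time step. *)
Lemma jet_flow_push (R : realType) n k (M M' : set 'rV[R]_n)
    (f g : 'rV[R]_n -> 'rV[R]_n) (S : sde R n k) (w : 'I_k -> R) (c : R) y t :
  diffeomorphism M M' f g -> smooth_sde M S -> M' y ->
  let X (S : sde R n k) z :=
    \sum_(alpha < k) w alpha *: vol S alpha z t + c *: strat_drift S z t in
  omap f (time1_flow M (X S) (g y)) = time1_flow M' (X (ito_push f g S)) y.
Proof.
move=> fg smS + X; have oM := diffeo_open_dom fg.
apply: (time1_flow_push fg) => [p Mp|z M'z].
  apply: lipschitz_onD; last first.
    by apply/lipschitz_onZ/(strat_drift_lipschitz t oM).
  apply: lipschitz_on_sum => alpha; apply: lipschitz_onZ.
  by apply: (class_C1_lipschitz oM) Mp; exact: smooth_sde_vol.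
rewrite /X [RHS]diff_lincomb (strat_drift_push t fg smS)//.
by under eq_bigr do rewrite (ito_push_vol S t _ fg M'z).
Qed.

Theorem theorem4p4 (R : realType) (n k : nat) :
  invariantly_defined (@dW2_jet_scheme R n k) /\
  invariantly_defined (@dt_jet_scheme R n k).
Proof.
split=> M M' f g S fg smS y t v M'y; exact: jet_flow_push.
Qed.
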